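(* Let $a<0$, $b\in\mathbb{R}$, and let $\lambda,\mu>0$ satisfy $$(\lambda a)^2+(\mu b)^2\le\frac12 .$$ Let $u^0\in\mathcal{H}$ and let $(u^n)_{n\in\mathbb{N}}$ be the sequence of elements of $\mathcal{H}$ generated by the half-space numerical scheme described in the context (Lax-Wendroff scheme on $\mathcal{I}=\mathbb{N}\times\mathbb{Z}$ together with the extrapolation boundary condition $u^n_{-1,k}=u^n_{0,k}$ for all $n\in\mathbb{N}$, $k\in\mathbb{Z}$). Then for any $n\in\mathbb{N}$, $$\|u^{n+1}\|_{\mathcal{H}}^2-\|u^n\|_{\mathcal{H}}^2+\frac{\lambda|a|}{2}\sum_{k\in\mathbb{Z}}(u_{0,k}^n)^2+(\mu b)^2\,\frac{(\lambda a)^2+(\mu b)^2}{16}\sum_{k\in\mathbb{Z}}(\Delta_2u_{0,k}^n)^2\le0 .$$ In particular, $$\sup_{n\in\mathbb{N}}\|u^n\|_{\mathcal{H}}^2+\frac{\lambda|a|}{2}\sum_{n\in\mathbb{N}}\sum_{k\in\mathbb{Z}}(u_{0,k}^n)^2+(\mu b)^2\,\frac{(\lambda a)^2+(\mu b)^2}{16}\sum_{n\in\mathbb{N}}\sum_{k\in\mathbb{Z}}(\Delta_2u_{0,k}^n)^2\le2\,\|u^0\|_{\mathcal{H}}^2 .$$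
   Context: $\mathbb{N}=\{0,1,2,\dots\}$. Let $\mathcal{I}=\mathbb{N}\times\mathbb{Z}$ (interior indices) and $\mathcal{J}=(\{-1\}\cup\mathbb{N})\times\mathbb{Z}$. Define $\mathcal{H}=\{u\in\ell^2(\mathcal{J};\mathbb{R}) : u_{-1,k}=u_{0,k}\ \text{for all }k\in\mathbb{Z}\}$, a Hilbert space with norm $\|u\|_{\mathcal{H}}^2=\sum_{(j,k)\in\mathcal{I}}u_{j,k}^2$ (only interior values are used). Notation: $\Delta_2u_{j,k}=(\Delta_2u)_{j,k}=u_{j,k+1}-2u_{j,k}+u_{j,k-1}$. Numerical scheme: given $u^n\in\mathcal{H}$, the values $u^{n+1}_{j,k}$ for $(j,k)\in\mathcal{I}$ are \begin{align*} u_{j,k}^{n+1} = u_{j,k}^n & - \frac{\lambda a}{2}\big(u_{j+1,k}^n-u_{j-1,k}^n\big) - \frac{\mu b}{2}\big(u_{j,k+1}^n-u_{j,k-1}^n\big)\\ & + \frac{(\lambda a)^2}{2}\big(u_{j+1,k}^n-2u_{j,k}^n+u_{j-1,k}^n\big) + \frac{(\mu b)^2}{2}\big(u_{j,k+1}^n-2u_{j,k}^n+u_{j,k-1}^n\big)\\ & + \frac{\lambda a\,\mu b}{4}\big(u_{j+1,k+1}^n-u_{j+1,k-1}^n-u_{j-1,k+1}^n+u_{j-1,k-1}^n\big)\\ & - \frac{(\lambda a)^2+(\mu b)^2}{8}\big(u_{j+1,k+1}^n-2u_{j+1,k}^n+u_{j+1,k-1}^n-2u_{j,k+1}^n+4u_{j,k}^n-2u_{j,k-1}^n\\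 &\qquad\qquad\qquad\qquad +u_{j-1,k+1}^n-2u_{j-1,k}^n+u_{j-1,k-1}^n\big), \end{align*} and the ghost values are determined by $u^{n+1}_{-1,k}=u^{n+1}_{0,k}$ for all $k\in\mathbb{Z}$, so that $u^{n+1}\in\mathcal{H}$. *)

(* Defs.v *)
From HB Require Import structures.
From mathcomp Require Import all_boot all_order all_algebra.
From mathcomp Require Import all_classical all_reals all_analysis.
From mathcomp Require Import ring lra zify.

Set Implicit Arguments.
Unset Strict Implicit.
Unset Printing Implicit Defensive.

Import Order.TTheory GRing.Theory Num.Theory.

Local Open Scope classical_set_scope.
Local Open Scope ring_scope.

(* Grid functions are total functions int -> int -> R, of which only the
   values at the indices of Jset matter: nothing below constrains or uses
   u j k for j < -1. *)

Definition Iset : set (int * int) := [set jk | 0 <= jk.1].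
Definition Jset : set (int * int) := [set jk | -1 <= jk.1].

Definition sq_summable (R : realType) (D : set (int * int))
    (u : int -> int -> R) : Prop :=
  summable D (fun jk => ((u jk.1 jk.2) ^+ 2)%:E).

Definition inH (R : realType) (u : int -> int -> R) : Prop :=
  sq_summable Jset u /\ forall k, u (-1) k = u 0 k.

Definition normH (R : realType) (u : int -> int -> R) : R :=
  Num.sqrt (fine (\esum_(jk in Iset) ((u jk.1 jk.2) ^+ 2)%:E)).

Definition Delta2 (R : realType) (u : int -> int -> R) (j k : int) : R :=
  u j (k + 1) - 2 * u j k + u j (k - 1).

Definition lax_wendroff (R : realType) (lam mu a b : R)
    (u : int -> int -> R) (j k : int) : R :=
  u j k
  - lam * a / 2 * (u (j + 1) k - u (j - 1) k)
  - mu * b / 2 * (u j (k + 1) - u j (k - 1))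
  + (lam * a) ^+ 2 / 2 * (u (j + 1) k - 2 * u j k + u (j - 1) k)
  + (mu * b) ^+ 2 / 2 * (u j (k + 1) - 2 * u j k + u j (k - 1))
  + lam * a * (mu * b) / 4
    * (u (j + 1) (k + 1) - u (j + 1) (k - 1)
       - u (j - 1) (k + 1) + u (j - 1) (k - 1))
  - ((lam * a) ^+ 2 + (mu * b) ^+ 2) / 8
    * (u (j + 1) (k + 1) - 2 * u (j + 1) k + u (j + 1) (k - 1)
       - 2 * u j (k + 1) + 4 * u j k - 2 * u j (k - 1)
       + u (j - 1) (k + 1) - 2 * u (j - 1) k + u (j - 1) (k - 1)).

Definition scheme_step (R : realType) (lam mu a b : R)
    (u v : int -> int -> R) : Prop :=
  (forall j k, 0 <= j -> v j k = lax_wendroff lam mu a b u j k) /\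
  (forall k, v (-1) k = v 0 k).

(* A sequence generated by scheme_step from an element of H stays in H
   (inH_scheme_step), and on H the function normH is the genuine, finite,
   norm (normH_sqE): the default value of fine is not used. *)

Section HilbertSpace.
Variable R : realType.
Implicit Types (D : set (int * int)) (u v : int -> int -> R).

Lemma sq_summableE D u : sq_summable D u <->
  (\esum_(jk in D) ((u jk.1 jk.2) ^+ 2)%:E < +oo)%E.
Proof.
rewrite /sq_summable /summable; under eq_esum => jk _.
  by rewrite gee0_abs ?lee_fin ?sqr_ge0//; over.
by [].
Qed.

Lemma sq_summable_sub D D' u : D `<=` D' -> sq_summable D' u ->
  sq_summable D u.
Proof.
move=> DD' /sq_summableE h; apply/sq_summableE; apply: le_lt_trans h.
rewrite (esumID D D'); last by move=> *; rewrite lee_fin sqr_ge0.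
rewrite (setIidr DD') leeDl//.
by apply: esum_ge0 => *; rewrite lee_fin sqr_ge0.
Qed.

Lemma normH_sqE u : inH u ->
  ((normH u ^+ 2)%:E = \esum_(jk in Iset) ((u jk.1 jk.2) ^+ 2)%:E)%E.
Proof.
move=> [uJ _].
have /sq_summableE : sq_summable Iset u.
  by apply: sq_summable_sub uJ => -[j k] /=; apply: le_trans.
have h0 : (0 <= \esum_(jk in Iset) ((u jk.1 jk.2) ^+ 2)%:E)%E.
  by apply: esum_ge0 => *; rewrite lee_fin sqr_ge0.
by move=> h; rewrite /normH sqr_sqrtr ?fine_ge0// fineK// ge0_fin_numE.
Qed.

Lemma sq_summableD D u v : sq_summable D u -> sq_summable D v ->
  sq_summable D (fun j k => u j k + v j k).
Proof.
move=> hu hv; have huv := summableD hu hv.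
have := summableD huv huv; apply: le_lt_trans.
apply: le_esum => -[j k] _ /=; rewrite lee_fin !ger0_norm ?sqr_ge0//.
  by have := sqr_ge0 (u j k - v j k); nra.
by rewrite !addr_ge0// sqr_ge0.
Qed.

Lemma sq_summableZ D (c : R) u : sq_summable D u ->
  sq_summable D (fun j k => c * u j k).
Proof.
move=> hu.
have [n] : exists n : nat, c ^+ 2 <= n%:R.
  by exists (Num.bound (c ^+ 2)); rewrite ltW// archi_boundP// sqr_ge0.
have hn : summable D (fun jk => (n%:R * (u jk.1 jk.2) ^+ 2)%:E).
  elim: n => [|n IH].
    by rewrite /summable esum1// => i _; rewrite mul0r abse0.
  have := summableD IH hu; congr summable; apply/funext => jk /=.
  by rewrite -natr1 mulrDl mul1r.
move=> cn; apply: le_lt_trans hn; apply: le_esum => -[j k] _ /=.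
rewrite lee_fin [leLHS]ger0_norm ?sqr_ge0// ger0_norm; last first.
  by rewrite mulr_ge0 ?sqr_ge0.
by rewrite exprMn ler_wpM2r// sqr_ge0.
Qed.

Lemma sq_summable_shift u (d e : int) : sq_summable Jset u -> -1 <= d ->
  sq_summable Iset (fun j k => u (j + d) (k + e)).
Proof.
move=> uJ d1; apply/sq_summableE.
have := @esum_image R _ _ Iset (fun jk : int * int => (jk.1 + d, jk.2 + e))
  (fun jk => ((u jk.1 jk.2) ^+ 2)%:E).
move=> /= <-; last first.
  by move=> [j k] [j' k'] _ _ /= [/addIr -> /addIr ->].
apply/sq_summableE; apply: sq_summable_sub uJ.
by move=> _ [[j k] /= j0 <-] /=; rewrite /Jset /= -[-1]add0r lerD.
Qed.

Lemma inH_scheme_step (lam mu a b : R) u v : inH u ->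
  scheme_step lam mu a b u v -> inH v.
Proof.
move=> [uJ _] [vI vB]; split => //.
have sh d e : -1 <= d -> sq_summable Iset (fun j k => u (j + d) (k + e)).
  exact: sq_summable_shift.
have {}vI' : sq_summable Iset v.
  apply/sq_summableE.
  under eq_esum => jk jkI do rewrite (vI _ _ jkI).
  apply/(@sq_summableE Iset (lax_wendroff lam mu a b u)).
  pose c (d e : int) : R := lax_wendroff lam mu a b
    (fun j k => ((j == d) && (k == e))%:R) 0 0.
  pose T (d e : int) j k := c d e * u (j + d) (k + e).
  have hT d e : -1 <= d -> sq_summable Iset (T d e).
    by move=> d1; apply: sq_summableZ; exact: sh.
  have h3 d : -1 <= d ->
      sq_summable Iset (fun j k => T d (-1) j k + T d 0 j k + T d 1 j k).
    by move=> d1; do 2 (apply: sq_summableD; last exact: hT); exact: hT.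
  have := sq_summableD (sq_summableD (h3 (-1) _) (h3 0 _)) (h3 1 _).
  move=> /(_ isT isT isT); congr sq_summable.
  apply/funext => j; apply/funext => k.
  by rewrite /T /c /lax_wendroff /= !addr0; field.
apply/sq_summableE; rewrite (esumID Iset); last first.
  by move=> *; rewrite lee_fin sqr_ge0.
apply: lte_add_pinfty.
  apply/sq_summableE; apply: sq_summable_sub vI'; exact: subIsetr.
have -> : Jset `&` ~` Iset = (fun jk : int * int => (jk.1 - 1, jk.2)) @`
    [set jk | jk.1 = 0].
  apply/seteqP; split => [[j k] /= [j1 /negP j0]|_ [[j k] /= -> <-]] //.
  exists (0, k) => //=; congr pair; move: j1 j0; rewrite /Jset /Iset /=; lia.
rewrite esum_image; last by move=> [j k] [j' k'] _ _ /= [/addIr -> ->].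
rewrite (@eq_esum _ _ _ _ (fun jk => ((v jk.1 jk.2) ^+ 2)%:E)).
  apply/sq_summableE; apply: sq_summable_sub vI'.
  by move=> [j k] /= ->; rewrite /Iset /=.
by move=> [j k] /= ->; rewrite sub0r vB.
Qed.

End HilbertSpace.

(* Main.v *)
(* Write al = lam a, be = mu b, t = al^2 + be^2, and, for frequencies (xi, eta),
   s1, c1 = sin, cos (xi / 2) and s2, c2 = sin, cos (eta / 2).  The
   amplification factor g of the scheme satisfies 1 - |g|^2 = 2 Q - P^2 with
     Q = 2 (s1^2 + s2^2) (al^2 s1^2 + be^2 s2^2),
     P = Q + (al sin xi + be sin eta)^2 / 2,
   and, decisively,
     (2 Q - P^2) / 4 = (1 / 2 - t) Q
       + t (s1^2 + s2^2) (al s1 c2 - be s2 c1)^2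
       + (2 t s1^2 s2^2 + (al s1 c2 + be s2 c1)^2) (al s2 c1 - be s1 c2)^2,
   which is nonnegative when t <= 1 / 2.  In physical space every term is the
   square of a finite difference centred at a node, an edge, a face or a cell,
   and u^2 - v^2 equals the sum of these squares up to a discrete divergence.
   Summing over the half-space leaves only the flux through j = -1/2, which the
   condition u_{-1,k} = u_{0,k} turns into the boundary terms of the estimate. *)
Require Import Defs.
From HB Require Import structures.
From mathcomp Require Import all_boot all_order all_algebra.
From mathcomp Require Import all_classical all_reals all_analysis.
From mathcomp Require Import ring lra zify.

Set Implicit Arguments.
Unset Strict Implicit.
Unset Printing Implicit Defensive.

Import Order.TTheory GRing.Theory Num.Theory.

Local Open Scope classical_set_scope.
Local Open Scope ring_scope.

(** * Signed sums of absolutely summable real families *)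

Section RealSums.
Variables (R : realType) (T : choiceType).
Implicit Types (D A B : set T) (f g : T -> R) (c : R).

Definition abs_summable D f := summable D (EFin \o f).

(* [esum] is a supremum of finite sums, hence only meaningful for nonnegative
   terms. *)
Definition rsum D f : R :=
  fine (\esum_(x in D) (EFin \o f)^\+ x - \esum_(x in D) (EFin \o f)^\- x).

Lemma le_abs_summable D f g : (forall x, D x -> `|f x| <= `|g x|) ->
  abs_summable D g -> abs_summable D f.
Proof.
move=> fg; apply: le_lt_trans; apply: le_esum => x Dx /=.
by rewrite lee_fin fg.
Qed.

Lemma sub_abs_summable D A f : A `<=` D -> abs_summable D f ->
  abs_summable A f.
Proof.
move=> AD; apply: le_lt_trans.
rewrite [leRHS](esumID A)// (setIidr AD) leeDl//.
exact: esum_ge0.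
Qed.

Lemma abs_summableD D f g : abs_summable D f -> abs_summable D g ->
  abs_summable D (fun x => f x + g x).
Proof. exact: summableD. Qed.

Lemma abs_summableB D f g : abs_summable D f -> abs_summable D g ->
  abs_summable D (fun x => f x - g x).
Proof. exact: summableB. Qed.

Lemma esumZl D c f : 0 <= c -> (forall x, 0 <= f x) ->
  (\esum_(x in D) (c * f x)%:E = c%:E * \esum_(x in D) (f x)%:E)%E.
Proof.
move=> c0 f0; rewrite /esum -ereal_supZl//; last first.
  apply/set0P; exists 0%E; exists set0; first exact: fsets_set0.
  by rewrite fsbig_set0.
congr ereal_sup; rewrite image_comp; apply: eq_imagel => A _ /=.
by rewrite ge0_mule_fsumr// => x; rewrite lee_fin.
Qed.

Lemma abs_summableZ D c f : abs_summable D f ->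
  abs_summable D (fun x => c * f x).
Proof.
move=> Df; rewrite /abs_summable /summable.
under eq_esum => x _ do rewrite /= normrM.
rewrite esumZl//; apply: lte_mul_pinfty => //.
Qed.

Lemma esum_fin_num D f : abs_summable D f -> (forall x, D x -> 0 <= f x) ->
  (\esum_(x in D) (f x)%:E \is a fin_num)%E.
Proof.
move=> Df f0; rewrite ge0_fin_numE; last first.
  by apply: esum_ge0 => x /f0; rewrite lee_fin.
apply: le_lt_trans Df; apply: le_esum => x /f0 fx /=.
by rewrite lee_fin ler_norm.
Qed.

(** Any splitting into nonnegative summable parts is allowed, overlapping ones included. Additivity
    relies on this: adding the positive and negative parts of two functions does not in general give
    those of the sum. *)
Lemma rsumB_ge0 D f g : abs_summable D f -> abs_summable D g ->
  (forall x, D x -> 0 <= f x) -> (forall x, D x -> 0 <= g x) ->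
  rsum D (fun x => f x - g x) =
  fine (\esum_(x in D) (f x)%:E) - fine (\esum_(x in D) (g x)%:E).
Proof.
move=> Df Dg f0 g0; rewrite -fineB ?esum_fin_num//.
by rewrite -(esumB Df Dg)//= => x Dx; rewrite lee_fin ?f0 ?g0.
Qed.

Lemma eq_rsum D f g : (forall x, D x -> f x = g x) -> rsum D f = rsum D g.
Proof.
move=> fg; rewrite /rsum; congr (fine (_ - _)); apply: eq_esum => x Dx.
  by rewrite !funeposE /= fg.
by rewrite !funenegE /= fg.
Qed.

Lemma rsum_ge0E D f : abs_summable D f -> (forall x, D x -> 0 <= f x) ->
  (\esum_(x in D) (f x)%:E = (rsum D f)%:E)%E.
Proof.
move=> Df f0; rewrite -[LHS]fineK ?esum_fin_num//; congr EFin.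
rewrite -[LHS]subr0 -[X in _ - X]/(fine 0%E).
rewrite -[X in _ - fine X](@esum1 R T D (fun=> 0%:E))//.
rewrite -rsumB_ge0//; first by apply: eq_rsum => x; rewrite subr0.
by apply: le_abs_summable Df => x _; rewrite normr0.
Qed.

Lemma rsum_ge0 D f : abs_summable D f -> (forall x, D x -> 0 <= f x) ->
  0 <= rsum D f.
Proof.
move=> Df f0; rewrite -lee_fin -rsum_ge0E//.
by apply: esum_ge0 => x /f0; rewrite lee_fin.
Qed.

Let pos f x := Num.max (f x) 0.
Let neg f x := Num.max (- f x) 0.

Let pos_ge0 f x : 0 <= pos f x. Proof. by rewrite le_max lexx orbT. Qed.
Let neg_ge0 f x : 0 <= neg f x. Proof. by rewrite le_max lexx orbT. Qed.

Let posB f x : f x = pos f x - neg f x.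
Proof.
rewrite /pos /neg; case: (leP (f x) 0) => f0.
  by rewrite max_l ?oppr_ge0// sub0r opprK.
by rewrite max_r ?subr0// oppr_le0 ltW.
Qed.

Let pos_summable D f : abs_summable D f -> abs_summable D (pos f).
Proof.
apply: le_abs_summable => x _; rewrite ger0_norm// ge_max normr_ge0.
by rewrite ler_norm.
Qed.

Let neg_summable D f : abs_summable D f -> abs_summable D (neg f).
Proof.
apply: le_abs_summable => x _; rewrite ger0_norm// ge_max normr_ge0.
by rewrite -normrN ler_norm.
Qed.

Let rsum_posB D f : abs_summable D f -> rsum D f =
  fine (\esum_(x in D) (pos f x)%:E) - fine (\esum_(x in D) (neg f x)%:E).
Proof.
move=> Df; rewrite -rsumB_ge0//.
- by apply: eq_rsum => x _; exact: posB.
- exact: pos_summable.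
- exact: neg_summable.
Qed.

Lemma rsumD D f g : abs_summable D f -> abs_summable D g ->
  rsum D (fun x => f x + g x) = rsum D f + rsum D g.
Proof.
move=> Df Dg.
pose p x := pos f x + pos g x; pose n x := neg f x + neg g x.
transitivity (rsum D (fun x => p x - n x)).
  by apply: eq_rsum => x _; rewrite (posB f) (posB g) /p /n; ring.
rewrite rsumB_ge0; last 4 first.
- by apply: abs_summableD; exact: pos_summable.
- by apply: abs_summableD; exact: neg_summable.
- by move=> x _; rewrite addr_ge0.
- by move=> x _; rewrite addr_ge0.
rewrite !rsum_posB//.
under eq_esum => x _ do rewrite /p EFinD.
rewrite [X in _ - fine X = _](_ : _ =
    \esum_(x in D) ((neg f x)%:E + (neg g x)%:E)%E)//.
rewrite !esumD//; do ?by move=> x _; rewrite lee_fin.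
rewrite !fineD ?esum_fin_num ?neg_summable ?pos_summable//.
by rewrite opprD addrACA.
Qed.

Lemma rsumB D f g : abs_summable D f -> abs_summable D g ->
  rsum D (fun x => f x - g x) = rsum D f - rsum D g.
Proof.
move=> Df Dg; apply/(canRL (addrK _)); rewrite -rsumD//; last first.
  exact: abs_summableB.
by apply: eq_rsum => x _; rewrite subrK.
Qed.

Lemma le_rsum D f g : abs_summable D f -> abs_summable D g ->
  (forall x, D x -> f x <= g x) -> rsum D f <= rsum D g.
Proof.
move=> Df Dg fg; rewrite -subr_ge0 -rsumB// rsum_ge0//.
  exact: abs_summableB.
by move=> x /fg; rewrite subr_ge0.
Qed.

Lemma rsumID A D f : abs_summable D f ->
  rsum D f = rsum (D `&` A) f + rsum (D `&` ~` A) f.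
Proof.
move=> Df; have DA : abs_summable (D `&` A) f.
  by apply: sub_abs_summable Df; exact: subIsetl.
have DC : abs_summable (D `&` ~` A) f.
  by apply: sub_abs_summable Df; exact: subIsetl.
rewrite !rsum_posB// (esumID A)//; last by move=> *; rewrite lee_fin.
rewrite [X in _ - fine X](esumID A)//; last by move=> *; rewrite lee_fin.
rewrite !fineD ?esum_fin_num ?neg_summable ?pos_summable//.
by rewrite opprD addrACA.
Qed.
End RealSums.

Lemma rsum_image (R : realType) (T T' : choiceType) (P : set T) (e : T -> T')
    (f : T' -> R) : set_inj P e -> rsum (e @` P) f = rsum P (f \o e).
Proof.
move=> ei; rewrite /rsum !esum_image//.
congr (fine (_ - _)); apply: eq_esum => x _.
  by rewrite !funeposE.
by rewrite !funenegE.
Qed.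

(** * Square-summable families and their products *)

Section SquareSummable.
Variables (R : realType) (T : choiceType) (D : set T).
Implicit Types (f g : T -> R) (c : R).

Definition square_summable f := abs_summable D (fun x => f x ^+ 2).

Lemma square_summableD f g : square_summable f -> square_summable g ->
  square_summable (fun x => f x + g x).
Proof.
move=> Df Dg.
apply: le_abs_summable (abs_summableZ 2 (abs_summableD Df Dg)) => x _.
rewrite [leLHS]ger0_norm ?sqr_ge0// [leRHS]ger0_norm; last first.
  by rewrite mulr_ge0 ?addr_ge0 ?sqr_ge0.
by have := sqr_ge0 (f x - g x); lra.
Qed.

Lemma square_summableZ c f : square_summable f ->
  square_summable (fun x => c * f x).
Proof.
move=> Df; apply: le_abs_summable (abs_summableZ (c ^+ 2) Df) => x _.
by rewrite exprMn.
Qed.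

Lemma square_summableB f g : square_summable f -> square_summable g ->
  square_summable (fun x => f x - g x).
Proof.
move=> Df Dg; apply: square_summableD => //.
by apply: le_abs_summable Dg => x _; rewrite sqrrN.
Qed.

Lemma abs_summableM f g : square_summable f -> square_summable g ->
  abs_summable D (fun x => f x * g x).
Proof.
move=> Df Dg; apply: le_abs_summable (abs_summableD Df Dg) => x _.
rewrite [leRHS]ger0_norm ?addr_ge0 ?sqr_ge0// ler_norml.
have := sqr_ge0 (f x - g x); have := sqr_ge0 (f x + g x).
by have := sqr_ge0 (f x); have := sqr_ge0 (g x); lra.
Qed.

End SquareSummable.

(** * Telescoping sums on the half-space *)

Section HalfSpace.
Variable R : realType.
Implicit Types (A : set (int * int)) (f : int * int -> R).

Definition bdry : set (int * int) := [set x | x.1 = 0].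

Lemma bdry_sub : bdry `<=` Iset.
Proof. by move=> x; rewrite /bdry /Iset /= => ->. Qed.

(** The unit shift in [k] permutes [A], so tangential fluxes cancel. *)
Lemma rsum_diff_k A f : (forall j k, A (j, k) -> A (j, k + 1)) ->
  (forall j k, A (j, k) -> A (j, k - 1)) ->
  abs_summable A f -> abs_summable A (fun x => f (x.1, x.2 + 1)) ->
  rsum A (fun x => f (x.1, x.2 + 1) - f x) = 0.
Proof.
move=> Ap Am Af Af1; rewrite rsumB//; apply/eqP; rewrite subr_eq0; apply/eqP.
rewrite -(@rsum_image _ _ _ A (fun x : int * int => (x.1, x.2 + 1))); last first.
  by move=> [j k] [j' k'] _ _ /= [-> /addIr ->].
congr (rsum _ f); apply/seteqP; split => [_ [[j k] Ajk <-]|[j k] Ajk].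
  exact: Ap.
by exists (j, k - 1); [exact: Am|rewrite /= subrK].
Qed.

(** The unit shift in [j] maps [Iset] onto [Iset] minus [bdry], so only the column [j = 0]
    survives. *)
Lemma rsum_diff_j f : abs_summable Iset f ->
  abs_summable Iset (fun x => f (x.1 + 1, x.2)) ->
  rsum Iset (fun x => f (x.1 + 1, x.2) - f x) = - rsum bdry f.
Proof.
move=> If If1; rewrite rsumB// (rsumID bdry If).
rewrite -(@rsum_image _ _ _ Iset (fun x : int * int => (x.1 + 1, x.2)) f); last first.
  by move=> [j k] [j' k'] _ _ /= [/addIr -> ->].
rewrite (setIidr bdry_sub) [X in rsum X _ - _](_ : _ = Iset `&` ~` bdry).
  by rewrite opprD addrCA subrr addr0.
apply/seteqP; split => [_ [[j k] /= j0 <-]|[j k] [/= j0 jN0]].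
  by split; move: j0; rewrite /Iset /bdry /=; lia.
exists (j - 1, k); last by rewrite /= subrK.
by move: j0 jN0; rewrite /Iset /bdry /=; lia.
Qed.

End HalfSpace.

(** * Local energy balance and boundary flux *)

Section Energy.
Variable R : realType.
Implicit Types (al be : R) (u v : int -> int -> R) (j k : int).

(** Up to a phase, the symbols of [edge_form], [face_form] and [cell_form] are [-4 s2 X], [-4 s1 X]
    and [-4 s1 s2], where [X = al s1 c2 - be s2 c1]. *)
Definition edge_form al be u j k : R :=
  al / 2 * ((u j (k + 1) - u j (k - 1))
            - (u (j - 1) (k + 1) - u (j - 1) (k - 1)))
  - be / 2 * (Delta2 u j k + Delta2 u (j - 1) k).

Definition face_form al be u j k : R :=
  let D1 k := (u (j + 1) k - u (j - 1) k) / 2 in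
  let L1 k := u (j + 1) k - 2 * u j k + u (j - 1) k in
  al / 2 * (L1 k + L1 (k - 1)) - be * (D1 k - D1 (k - 1)).

Definition cell_form u j k : R :=
  u j k - u (j - 1) k - u j (k - 1) + u (j - 1) (k - 1).

(* [flux_j u j k] lives on the edge between the nodes (j - 1, k) and (j, k), and
   [flux_k u j k] on the one between (j, k - 1) and (j, k).  They solve the
   linear system that makes [energy_identity] hold; the solution was chosen
   covariant under the reflections of both axes, but for the last term of
   [flux_j], which reads the edge squares at j + 1/2 rather than averaging them
   over j - 1/2 and j + 1/2. *)
Definition flux_j al be u j k : R :=
  let t := al ^+ 2 + be ^+ 2 in
  let S l := u j l + u (j - 1) l in
  let D l := u j l - u (j - 1) l in
  let D2 l := D (l + 1) - 2 * D l + D (l - 1) in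
  let S2 l := S (l + 1) - 2 * S l + S (l - 1) in
  al / 4 * S k ^+ 2
  - al * be ^+ 2 / 8 * ((S k - S (k - 1)) * (S k - S (k + 1)))
  + (al ^+ 3 / 2 - al / 4) * D k ^+ 2
  - al * t / 8 * (D k * D2 k)
  + al * be ^+ 2 / 8 * ((D k - D (k - 1)) * (D k - D (k + 1)))
  + t / 16 * (D k * S2 k) + t / 16 * (S k * D2 k)
  - al ^+ 2 / 2 * (D k * S k)
  + be * t / 16 * (D (k + 1) * S (k - 1))
  - be * t / 16 * (D (k - 1) * S (k + 1))
  + be * (be ^+ 2 + 3 * al ^+ 2) / 16 * (D k * (S (k + 1) - S (k - 1)))
  - be * (be ^+ 2 + 3 * al ^+ 2) / 16 * (S k * (D (k + 1) - D (k - 1)))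
  - t / 8 * edge_form al be u j k ^+ 2.

Definition flux_k al be u j k : R :=
  let t := al ^+ 2 + be ^+ 2 in
  let S i := u i k + u i (k - 1) in
  let D i := u i k - u i (k - 1) in
  let S1 := S (j + 1) - S (j - 1) in
  let D1 := D (j + 1) - D (j - 1) in
  let S2 := S (j + 1) - 2 * S j + S (j - 1) in
  let D2 := D (j + 1) - 2 * D j + D (j - 1) in
  be / 4 * S j ^+ 2 + (be ^+ 3 / 2 - be / 4) * D j ^+ 2
  - be ^+ 3 / 8 * (D j * D2)
  + al ^+ 2 * be / 16 * S1 ^+ 2 - al ^+ 2 * be / 16 * D1 ^+ 2
  + al ^+ 2 * be / 8 * (S j * S2) - al ^+ 2 * be / 4 * (D j * D2)
  + al * be / 4 * (D j * D1) - al * be / 4 * (S j * S1)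
  + al * be * t / 4 * (D1 * D2)
  + t / 8 * (S j * (D (j - 1) + D (j + 1) - D j))
  - t / 16 * (D (j - 1) * S (j - 1)) - t / 16 * (D (j + 1) * S (j + 1))
  - be ^+ 2 / 2 * (D j * S j)
  + (al * be ^+ 2 / 4 + al * t / 16) * (D j * S1)
  - al * t / 16 * (S j * D1)
  + al * t / 16 * (D (j + 1) * S (j - 1))
  - al * t / 16 * (D (j - 1) * S (j + 1)).

(** The squares follow the symbol identity for [2 Q - P^2]: the group with factor [1 - 2 * t] gives
    the term in [Q], the edge and face squares give the term in [t (s1^2 + s2^2)], and the last two
    squares give the two parts of the remaining term. *)
Lemma energy_identity (lam mu a b : R) u j k :
  let al := lam * a in let be := mu * b in
  let t := al ^+ 2 + be ^+ 2 in
  let D1 k := (u (j + 1) k - u (j - 1) k) / 2 in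
  let D2 j := (u j (k + 1) - u j (k - 1)) / 2 in
  let L1 k := u (j + 1) k - 2 * u j k + u (j - 1) k in
  u j k ^+ 2 - lax_wendroff lam mu a b u j k ^+ 2 =
  (1 - 2 * t) / 4 * (al ^+ 2 * L1 k ^+ 2 + be ^+ 2 * Delta2 u j k ^+ 2
    + t / 4 * (cell_form u j k ^+ 2 + cell_form u (j + 1) k ^+ 2
      + cell_form u j (k + 1) ^+ 2 + cell_form u (j + 1) (k + 1) ^+ 2))
  + t / 4 * edge_form al be u (j + 1) k ^+ 2
  + t / 8 * (face_form al be u j k ^+ 2 + face_form al be u j (k + 1) ^+ 2)
  + t / 8 * (al * (D1 (k + 1) - 2 * D1 k + D1 (k - 1))
             - be * (D2 (j + 1) - 2 * D2 j + D2 (j - 1))) ^+ 2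
  + 1 / 4 * ((al ^+ 2 - be ^+ 2) * (D2 (j + 1) - D2 (j - 1)) / 2
             - al * be * (L1 k - Delta2 u j k)) ^+ 2
  + (flux_j al be u (j + 1) k - flux_j al be u j k)
  + (flux_k al be u j (k + 1) - flux_k al be u j k).
Proof.
rewrite /flux_j /flux_k /edge_form /face_form /cell_form /lax_wendroff.
rewrite /Delta2 /=.
(* Collapsing the shifts [j + 1 - 1] and [k + 1 - 1] leaves exactly the nine stencil values, which
   then become independent variables of a polynomial identity. *)
rewrite !addrK.
set al := lam * a; set be := mu * b.
do 9 move: (u _ _) => ?.
by field.
Qed.

(** The CFL bound gives [1 - 2 * t >= 0], the only coefficient of a square whose sign is not
    automatic. *)
Lemma local_energy_le (lam mu a b : R) u j k :
  let al := lam * a in let be := mu * b in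
  al ^+ 2 + be ^+ 2 <= 1 / 2 ->
  lax_wendroff lam mu a b u j k ^+ 2
  + (flux_j al be u (j + 1) k - flux_j al be u j k)
  + (flux_k al be u j (k + 1) - flux_k al be u j k) <= u j k ^+ 2.
Proof.
move=> al be t_le.
set dF := flux_j _ _ _ _ _ - _; set dG := flux_k _ _ _ _ _ - _.
suff : 0 <= u j k ^+ 2 - lax_wendroff lam mu a b u j k ^+ 2 - dG - dF by lra.
rewrite energy_identity -/al -/be !addrK.
have t0 : 0 <= al ^+ 2 + be ^+ 2 by rewrite addr_ge0 ?sqr_ge0.
have t1 : 0 <= 1 - 2 * (al ^+ 2 + be ^+ 2) by lra.
by repeat first [done | apply: sqr_ge0 | apply: addr_ge0 | apply: divr_ge0
  | apply: mulr_ge0].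
Qed.

(** Every jump [D] vanishes and [S] doubles the trace; [edge_form] reduces to [- be * Delta2 u 0 k],
    whose square supplies the last term. *)
Lemma flux_j_boundary al be u k : (forall l, u (-1) l = u 0 l) ->
  flux_j al be u 0 k =
  al * (u 0 k ^+ 2 + be ^+ 2 / 8 * (u 0 (k + 1) - u 0 (k - 1)) ^+ 2
        - be ^+ 2 / 8 * Delta2 u 0 k ^+ 2)
  - be ^+ 2 * (al ^+ 2 + be ^+ 2) / 8 * Delta2 u 0 k ^+ 2.
Proof.
by move=> u0; rewrite /flux_j /edge_form /Delta2 /= !sub0r !u0; field.
Qed.

Definition boundary_energy al be u k : R :=
  `|al| / 2 * u 0 k ^+ 2
  + be ^+ 2 * ((al ^+ 2 + be ^+ 2) / 16) * Delta2 u 0 k ^+ 2.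

(* The telescoping correction encodes
   sum_k (Delta2 u 0 k)^2 <= 16 sum_k (u 0 k)^2. *)
Lemma boundary_energy_le al be u : al < 0 -> al ^+ 2 + be ^+ 2 <= 1 / 2 ->
  (forall k, u (-1) k = u 0 k) ->
  exists c, forall k, boundary_energy al be u k <=
    - flux_j al be u 0 k + (c * (u 0 (k + 1) ^+ 2 - u 0 (k + 1 - 1) ^+ 2)
                            - c * (u 0 k ^+ 2 - u 0 (k - 1) ^+ 2)).
Proof.
move=> al0 t_le u0.
pose c := Num.max (be ^+ 2 * (2 * `|al| - (al ^+ 2 + be ^+ 2)) / 16) 0.
have c0 : 0 <= c by rewrite le_max lexx orbT.
have c_ge : be ^+ 2 * (2 * `|al| - (al ^+ 2 + be ^+ 2)) / 16 <= c.
  by rewrite le_max lexx.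
have c_le : 16 * c <= `|al| / 2.
  rewrite /c; case: (leP _ 0) => _; first by have := normr_ge0 al; lra.
  rewrite ltr0_norm//.
  set A := - al; have A0 : 0 < A by rewrite oppr_gt0.
  have A1 : A <= 1.
    by have := sqr_ge0 be; move: t_le; rewrite -(sqrrN al) -/A; nra.
  (* be^2 (2 A - A^2 - be^2) <= (A - A^2 / 2)^2 <= A / 2 on [0, 1]. *)
  have : 0 <= (be ^+ 2 - (2 * A - A ^+ 2) / 2) ^+ 2 by exact: sqr_ge0.
  have : 0 <= A * (2 - A * (2 - A) ^+ 2).
    by rewrite mulr_ge0 ?ltW//; nra.
  rewrite -(sqrrN al) -/A; move: (be ^+ 2) => B; lra.
(* The telescoping term equals [4 * c * (x ^+ 2 - 2 * y ^+ 2 + z ^+ 2)]; it trades the neighbours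
   [x], [z] for [y], leaving [16 * c * y ^+ 2]. *)
exists (4 * c) => k; rewrite /boundary_energy flux_j_boundary// addrK /Delta2.
move: (u 0 (k + 1)) (u 0 k) (u 0 (k - 1)) => x y z.
rewrite (ltr0_norm al0) in c_ge c_le *.
have := ler_wpM2r (sqr_ge0 (x - 2 * y + z)) c_ge.
have := ler_wpM2r (sqr_ge0 y) c_le.
(* Cauchy-Schwarz with weights 1, 2, 1. *)
have : 0 <= c * (4 * (x ^+ 2 + 2 * y ^+ 2 + z ^+ 2) - (x - 2 * y + z) ^+ 2).
  rewrite mulr_ge0//.
  by have := sqr_ge0 (x - z); have := sqr_ge0 (x + 2 * y + z);
     have := sqr_ge0 (x + y); have := sqr_ge0 (y + z); nra.
have : 0 <= - al * (be ^+ 2 * (x - z) ^+ 2).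
  by apply: mulr_ge0; [lra|rewrite mulr_ge0 ?sqr_ge0].
lra.
Qed.

(** * Summability of the fluxes and boundary terms *)

Lemma square_summable_grid u (p q : int * int -> int) :
  sq_summable Jset u -> (forall x, Iset x -> -1 <= p x) ->
  set_inj Iset (fun x => (p x, q x)) ->
  square_summable Iset (fun x => u (p x) (q x)).
Proof.
move=> uJ p1 pq; have : abs_summable ((fun x => (p x, q x)) @` Iset)
    (fun x => u x.1 x.2 ^+ 2).
  apply: sub_abs_summable uJ => _ [x Ix <-].
  exact: p1.
by rewrite /abs_summable /summable esum_image.
Qed.

Lemma abs_summable_comp (T T' : choiceType) (P : set T) (Q : set T')
    (e : T -> T') (f : T' -> R) :
  set_inj P e -> e @` P `<=` Q -> abs_summable Q f ->
  abs_summable P (fun x => f (e x)).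
Proof.
move=> ei eQ /(sub_abs_summable eQ).
by rewrite /abs_summable /summable esum_image.
Qed.

(* A product is read as a scaling only if the first factor does not depend on
   [x]: otherwise [abs_summableZ] fails and [abs_summableM] is tried. *)
Ltac summable_form :=
  repeat match goal with
  | |- is_true (abs_summable ?D (fun x => @?f x - @?g x)) =>
      apply: (@abs_summableB _ _ D f g)
  | |- is_true (abs_summable ?D (fun x => @?f x + @?g x)) =>
      apply: (@abs_summableD _ _ D f g)
  | |- is_true (abs_summable ?D (fun x => ?c * @?f x)) =>
      apply: (@abs_summableZ _ _ D c f)
  | |- is_true (abs_summable ?D (fun x => @?f x * @?g x)) =>
      apply: (@abs_summableM _ _ D f g)
  | |- is_true (abs_summable ?D (fun x => @?f x ^+ 2)) =>
      change (is_true (square_summable D f))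
  | |- is_true (square_summable ?D (fun x => @?f x - @?g x)) =>
      apply: (@square_summableB _ _ D f g)
  | |- is_true (square_summable ?D (fun x => @?f x + @?g x)) =>
      apply: (@square_summableD _ _ D f g)
  | |- is_true (square_summable ?D (fun x => ?c * @?f x)) =>
      apply: (@square_summableZ _ _ D c f)
  end;
  match goal with
  | |- is_true (square_summable _ (fun x => ?u (@?p x) (@?q x))) =>
      apply: (@square_summable_grid u p q) => //= -[? ?];
        [rewrite /Iset /=; lia | move=> [? ?] _ _ /= [? ?]; congr pair; lia]
  end.

Lemma abs_summable_flux_j al be u : sq_summable Jset u ->
  abs_summable Iset (fun x => flux_j al be u x.1 x.2).
Proof.
by move=> uJ; rewrite /flux_j /edge_form /Delta2 /=; summable_form.
Qed.

Lemma abs_summable_flux_k al be u : sq_summable Jset u ->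
  abs_summable Iset (fun x => flux_k al be u x.1 x.2).
Proof. by move=> uJ; rewrite /flux_k /=; summable_form. Qed.

Lemma square_summable_Iset u : inH u ->
  square_summable Iset (fun x => u x.1 x.2).
Proof.
move=> [uJ _]; apply: sub_abs_summable uJ => x; exact: le_trans.
Qed.

Lemma normH_sq_rsum u : inH u ->
  normH u ^+ 2 = rsum Iset (fun x => u x.1 x.2 ^+ 2).
Proof.
move=> uH; apply: EFin_inj; rewrite normH_sqE// rsum_ge0E//.
  exact: square_summable_Iset.
by move=> x _; rewrite sqr_ge0.
Qed.

Lemma square_summable_boundary u l : inH u ->
  square_summable bdry (fun x => u 0 (x.2 + l)).
Proof.
move=> [uJ _]; have : square_summable Iset (fun x => u x.1 (x.2 + l)).
  apply: (square_summable_grid uJ) => -[? ?]; first by rewrite /Iset /=; lia.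
  by move=> [? ?] _ _ /= [? ?]; congr pair; lia.
move/(sub_abs_summable bdry_sub); apply: le_abs_summable => x.
by rewrite /bdry /= => ->.
Qed.

Lemma square_summable_boundary0 u : inH u ->
  square_summable bdry (fun x => u 0 x.2).
Proof.
move/(square_summable_boundary 0); apply: le_abs_summable => x _.
by rewrite addr0.
Qed.

Lemma abs_summable_boundary_energy al be u : inH u ->
  abs_summable bdry (fun x => boundary_energy al be u x.2).
Proof.
move=> uH; have u0 := square_summable_boundary0 uH.
apply: abs_summableD; apply: abs_summableZ => //.
apply: square_summableD; last exact: square_summable_boundary.
apply: square_summableB; first exact: square_summable_boundary.
exact: square_summableZ.
Qed.

Lemma boundary_weight_ge0 al be :
  0 <= be ^+ 2 * ((al ^+ 2 + be ^+ 2) / 16).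
Proof. by rewrite mulr_ge0 ?sqr_ge0// divr_ge0// addr_ge0 ?sqr_ge0. Qed.

Lemma boundary_energy_ge0 al be u k : 0 <= boundary_energy al be u k.
Proof.
by apply: addr_ge0; rewrite mulr_ge0 ?sqr_ge0 ?divr_ge0 ?boundary_weight_ge0.
Qed.

(** Summing [local_energy_le] over [Iset] leaves only the normal flux through the boundary, which
    [boundary_energy_le] controls after summation over [k]. *)
Lemma energy_decay (lam mu a b : R) u v :
  a < 0 -> 0 < lam -> (lam * a) ^+ 2 + (mu * b) ^+ 2 <= 1 / 2 ->
  inH u -> scheme_step lam mu a b u v ->
  normH v ^+ 2 + rsum bdry (fun x => boundary_energy (lam * a) (mu * b) u x.2)
    <= normH u ^+ 2.
Proof.
move=> a0 lam0 cfl uH uv; have [uJ ub] := uH; have vH := inH_scheme_step uH uv.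
rewrite !normH_sq_rsum//.
set al := lam * a; set be := mu * b.
have al0 : al < 0 by rewrite pmulr_rlt0.
pose F x := flux_j al be u x.1 x.2; pose G x := flux_k al be u x.1 x.2.
have IF : abs_summable Iset F := abs_summable_flux_j al be uJ.
have IG : abs_summable Iset G := abs_summable_flux_k al be uJ.
have IF1 : abs_summable Iset (fun x => F (x.1 + 1, x.2)).
  apply: (abs_summable_comp _ _ IF).
    by move=> [j k] [j' k'] _ _ /= [/addIr -> ->].
  by move=> _ [[j k] j0 <-]; move: j0; rewrite /Iset /=; lia.
have IG1 : abs_summable Iset (fun x => G (x.1, x.2 + 1)).
  apply: (abs_summable_comp _ _ IG).
    by move=> [j k] [j' k'] _ _ /= [-> /addIr ->].
  by move=> _ [[j k] j0 <-].
have Iu := square_summable_Iset uH; have Iv := square_summable_Iset vH.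
have IdF := abs_summableB IF1 IF; have IdG := abs_summableB IG1 IG.
have main : rsum Iset (fun x => v x.1 x.2 ^+ 2) - rsum bdry F
    <= rsum Iset (fun x => u x.1 x.2 ^+ 2).
  rewrite -rsum_diff_j// -[leLHS]addr0 -(@rsum_diff_k _ Iset G)//.
  rewrite -rsumD// -rsumD//; last exact: abs_summableD.
  apply: le_rsum => //.
    by apply: abs_summableD => //; exact: abs_summableD.
  by move=> [j k] Ijk /=; rewrite (uv.1 _ _ Ijk) local_energy_le.
have [c hc] := boundary_energy_le al0 cfl ub.
(* The correction in [hc] is the [k]-difference of [H], so it sums to zero along [bdry]. *)
pose H (x : int * int) := c * (u 0 x.2 ^+ 2 - u 0 (x.2 - 1) ^+ 2).
have bH : abs_summable bdry H.
  apply: abs_summableZ; apply: abs_summableB.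
    exact: square_summable_boundary0.
  exact: square_summable_boundary.
have bH1 : abs_summable bdry (fun x => H (x.1, x.2 + 1)).
  apply: (abs_summable_comp _ _ bH); last by move=> _ [[j k] j0 <-].
  by move=> [j k] [j' k'] _ _ /= [-> /addIr ->].
have bF : abs_summable bdry F := sub_abs_summable bdry_sub IF.
have bE := abs_summable_boundary_energy al be uH.
suff : rsum bdry (fun x => boundary_energy al be u x.2) + rsum bdry F <= 0 by lra.
rewrite -rsumD// -(@rsum_diff_k _ bdry H)//.
apply: le_rsum; [exact: abs_summableD|exact: abs_summableB|].
move=> [j k]; rewrite /bdry /F /H /= => ->.
by rewrite -lerBrDr addrC hc.
Qed.

(** * Return to extended-real sums and summation in time *)

Lemma bdry_image : bdry = (fun k : int => (0, k)) @` [set: int].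
Proof.
by rewrite /bdry; apply/seteqP; split => [[j k] /= ->|_ [k _ <-]] //; exists k.
Qed.

Lemma rsum_boundary_energy al be u : inH u ->
  ((`|al| / 2)%:E * (\esum_(k in [set: int]) (u 0%R k ^+ 2)%:E)
   + (be ^+ 2 * ((al ^+ 2 + be ^+ 2) / 16))%:E
     * (\esum_(k in [set: int]) (Delta2 u 0%R k ^+ 2)%:E)
   = (rsum bdry (fun x => boundary_energy al be u x.2))%:E)%E.
Proof.
move=> uH.
rewrite -rsum_ge0E; [|exact: abs_summable_boundary_energy|]; last first.
  by move=> x _; exact: boundary_energy_ge0.
rewrite bdry_image esum_image; last by move=> k l _ _ [].
have t0 := boundary_weight_ge0 al be.
rewrite -!esumZl ?divr_ge0//; do ?by move=> k; exact: sqr_ge0.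
by rewrite -esumD//= => k _; rewrite lee_fin mulr_ge0 ?sqr_ge0 ?divr_ge0.
Qed.

End Energy.

Theorem theorem3p1 (R : realType) (a b lam mu : R)
  (ha : a < 0) (hlam : 0 < lam) (hmu : 0 < mu)
  (hcfl : (lam * a) ^+ 2 + (mu * b) ^+ 2 <= 1 / 2)
  (u : nat -> int -> int -> R)
  (hu0 : inH (u 0%N))
  (hu : forall n : nat, scheme_step lam mu a b (u n) (u n.+1)) :
  (forall n : nat,
    ((normH (u n.+1) ^+ 2 - normH (u n) ^+ 2)%:E
     + (lam * `|a| / 2)%:E
       * (\esum_(k in [set: int]) (u n 0 k ^+ 2)%:E)
     + ((mu * b) ^+ 2 * (((lam * a) ^+ 2 + (mu * b) ^+ 2) / 16))%:E
       * (\esum_(k in [set: int]) (Delta2 (u n) 0 k ^+ 2)%:E)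
     <= 0)%E)
  /\
  (ereal_sup [set (normH (u n) ^+ 2)%:E | n in [set: nat]]
   + (lam * `|a| / 2)%:E
     * (\sum_(0 <= n <oo) (\esum_(k in [set: int]) (u n 0 k ^+ 2)%:E))
   + ((mu * b) ^+ 2 * (((lam * a) ^+ 2 + (mu * b) ^+ 2) / 16))%:E
     * (\sum_(0 <= n <oo)
          (\esum_(k in [set: int]) (Delta2 (u n) 0 k ^+ 2)%:E))
   <= (2 * normH (u 0%N) ^+ 2)%:E)%E.
Proof.
have uH n : inH (u n) by elim: n => // n IH; exact: inH_scheme_step (hu n).
have <- : `|lam * a| = lam * `|a| by rewrite normrM gtr0_norm.
set al := lam * a; set be := mu * b.
pose d n := rsum bdry (fun x => boundary_energy al be (u n) x.2).
have decay n : normH (u n.+1) ^+ 2 + d n <= normH (u n) ^+ 2.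
  exact: energy_decay.
have d0 n : 0 <= d n.
  apply: rsum_ge0; first exact: abs_summable_boundary_energy.
  by move=> x _; exact: boundary_energy_ge0.
split => [n|].
  rewrite -addeA rsum_boundary_energy// -EFinD lee_fin.
  by have := decay n; rewrite /d; lra.
have le0 m : normH (u m) ^+ 2 + \sum_(0 <= n < m) d n <= normH (u 0%N) ^+ 2.
  elim: m => [|m IH]; first by rewrite big_nil addr0.
  by rewrite big_nat_recr//=; have := decay m; lra.
have esum0 (f : int -> R) : (0 <= \esum_(k in [set: int]) (f k ^+ 2)%:E)%E.
  by apply: esum_ge0 => k _; rewrite lee_fin sqr_ge0.
have t0 := boundary_weight_ge0 al be.
rewrite -addeA -!nneseriesZl//.
rewrite -nneseriesD//; last 2 first.
- by move=> n _ _; rewrite mule_ge0 ?lee_fin ?divr_ge0.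
- by move=> n _ _; rewrite mule_ge0 ?lee_fin.
under eq_eseriesr => n _ do rewrite rsum_boundary_energy// -/(d n).
(* The factor 2 arises here: the supremum and the dissipation series are each bounded by the initial
   energy through [le0]. *)
rewrite mulr_natl mulr2n EFinD leeD//.
  apply: ge_ereal_sup => _ [m _ <-]; rewrite lee_fin.
  by apply: le_trans (le0 m); rewrite lerDl; exact: sumr_ge0.
apply: lime_le; first by apply: is_cvg_nneseries => n _ _; rewrite lee_fin d0.
apply: nearW => m; rewrite sumEFin lee_fin.
by apply: le_trans (le0 m); rewrite lerDr sqr_ge0.
Qed.
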